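(* For any $m\ge 2$ and for all $Z\in \mathcal{C}_m$, we have $\mathcal{K}_{ij}(\pi_X(Z),\pi_x(Z))\succeq 0$ for all $i,j\in[m]$.
   Context: Let $[m]=\{1,\dots,m\}$, let $n\ge 1$, and let $c^i\in\mathbb{R}^n$, $r_i\in\mathbb{R}$ for $i\in[m]$ be such that $S:=\{x\in\mathbb{R}^n: \|x-c^i\|_2\le r_i,\ \forall i\in[m]\}$ is nonempty. $\mathbb{S}^k$ is the space of real symmetric $k\times k$ matrices, $\mathbb{S}^k_+$ the cone of positive semidefinite ones, $A\succeq 0$ means $A$ is positive semidefinite, and $\langle A,B\rangle=\operatorname{tr}(AB)$ for symmetric matrices. The second-order cone is $\mathbb{L}^{n+2}:=\{x\in\mathbb{R}^{n+2}: \|(x_1,\ldots,x_{n+1})\|_2\le x_{n+2}\}$. With $I$ the $n\times n$ identity, define $$Q:=\begin{bmatrix}-2I & 0 & 0\\0 & 0 & 1\\0 & 1 & 0\end{bmatrix},\quad P:=\begin{bmatrix}2I & 0 & 0\\ 0 & 1 & -1\\0 & 1 & 1\end{bmatrix},\quad d^i:=\begin{bmatrix}2c^i\\ -1\\ r_i^2-\|c^i\|_2^2\end{bmatrix}\in\mathbb{R}^{n+2},\ i\in[m],$$ $$\mathcal{C}_m:=\{Z\in\mathbb{S}^{n+2}_+:\ \langle Q,Z\rangle=0,\ PZd^i\in\mathbb{L}^{n+2}\ \forall i\in[m],\ (d^i)^\top Zd^j\ge 0\ \forall i,j\in[m]\}.$$ For $Z\in\mathbb{S}^{n+2}$, $\pi_X(Z)\in\mathbb{S}^n$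 is the leading principal $n\times n$ submatrix of $Z$ and $\pi_x(Z):=(Z_{1,n+2},\ldots,Z_{n,n+2})^\top\in\mathbb{R}^n$. For $u\in\mathbb{R}^n$, $r\in\mathbb{R}$, let $\mathcal{A}(u,r):=\begin{bmatrix} rI & u\\ u^\top & r\end{bmatrix}\in\mathbb{S}^{n+1}$. For $i,j\in[m]$, the map $\mathcal{K}_{ij}:\mathbb{S}^n\oplus\mathbb{R}^n\to\mathbb{S}^{(n+1)^2}$ is obtained from the Kronecker product $\mathcal{A}(x-c^i,r_i)\otimes\mathcal{A}(x-c^j,r_j)$, whose entries are quadratic functions of $x$, by replacing each quadratic term $x_kx_l$ by $X_{kl}$ (and $x_k^2$ by $X_{kk}$); $\mathcal{K}_{ij}(X,x)$ denotes the resulting matrix.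
   Formalization: The formal theorem adds the normalization Z_{n+2,n+2}=1; without it the claim is false, e.g. n=1, m=2, c^1=c^2=2, r_1=r_2=1, Z=0 lies in C_m but K_ij(0,0)=A(-2,1)⊗A(-2,1) has eigenvalue -3. *)

(* Defs.v *)
From HB Require Import structures.
From mathcomp Require Import all_boot all_order all_algebra.
From mathcomp Require Import mathcomp_extra boolp classical_sets reals.
From mathcomp Require Import mxtens.

Set Implicit Arguments.
Unset Strict Implicit.
Unset Printing Implicit Defensive.

Import Order.TTheory GRing.Theory Num.Theory.
Local Open Scope ring_scope.

(* R^(n+2) is 'cV_(n + (1 + 1)), split into blocks of sizes n, 1 and 1. *)

Definition norm2 (R : rcfType) (k : nat) (x : 'cV[R]_k) : R :=
  Num.sqrt (\sum_i x i 0 ^+ 2).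

Definition psdmx (R : rcfType) (k : nat) (A : 'M[R]_k) : Prop :=
  A^T = A /\ forall x : 'cV[R]_k, 0 <= (x^T *m A *m x) 0 0.

Definition mxinner (R : rcfType) (k : nat) (A B : 'M[R]_k) : R :=
  \tr (A *m B).

Definition ball_inter (R : rcfType) (n m : nat) (c : 'I_m -> 'cV[R]_n)
    (r : 'I_m -> R) : set 'cV[R]_n :=
  [set x | forall i, norm2 (x - c i) <= r i].

(* With x = (y, s, t): the Euclidean norm of (y, s) is at most t. *)
Definition soc (R : rcfType) (n : nat) : set 'cV[R]_(n + (1 + 1)) :=
  [set x | norm2 (col_mx (usubmx x) (usubmx (dsubmx x)))
           <= dsubmx (dsubmx x) 0 0].

Definition Qmx (R : rcfType) (n : nat) : 'M[R]_(n + (1 + 1)) :=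
  block_mx (- 2%:M) 0
           0        (block_mx 0 1 1 0).

Definition Pmx (R : rcfType) (n : nat) : 'M[R]_(n + (1 + 1)) :=
  block_mx 2%:M 0
           0    (block_mx 1 (- 1) 1 1).

Definition dvec (R : rcfType) (n : nat) (c : 'cV[R]_n) (r : R) :
    'cV[R]_(n + (1 + 1)) :=
  col_mx (2 *: c) (col_mx (- 1) (r ^+ 2 - norm2 c ^+ 2)%:M).

Definition Ccone (R : rcfType) (n m : nat) (c : 'I_m -> 'cV[R]_n)
    (r : 'I_m -> R) : set 'M[R]_(n + (1 + 1)) :=
  [set Z | [/\ psdmx Z,
               mxinner (Qmx R n) Z = 0,
               forall i, soc (Pmx R n *m Z *m dvec (c i) (r i)) &
               forall i j,
                 0 <= ((dvec (c i) (r i))^T *m Z *m dvec (c j) (r j)) 0 0]].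

Definition piX (R : rcfType) (n : nat) (Z : 'M[R]_(n + (1 + 1))) : 'M[R]_n :=
  ulsubmx Z.

Definition pix (R : rcfType) (n : nat) (Z : 'M[R]_(n + (1 + 1))) : 'cV[R]_n :=
  rsubmx (ursubmx Z).

(* Z_{n+2,n+2}, the homogenizing coordinate: it is 1 on the lifted points z z^T
   with z = (x, |x|^2, 1).  Ccone is a cone whereas kron_lift is affine in
   (X, x), so the two are only comparable on the slice corner Z = 1. *)
Definition corner (R : rcfType) (n : nat) (Z : 'M[R]_(n + (1 + 1))) : R :=
  drsubmx (drsubmx Z) 0 0.

Definition arrowmx (R : rcfType) (n : nat) (u : 'cV[R]_n) (r : R) :
    'M[R]_(n + 1) :=
  block_mx r%:M u u^T r%:M.

(* As arrowmx (x - c) r = arrowmx (- c) r + \sum_k x_k *: arrowmx e_k 0, the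
   Kronecker product of arrowmx (x - c) r and arrowmx (x - c') r' expands into
   its constant, linear and quadratic parts in x; in the quadratic part
   x_k * x_l is replaced by X k l.  See kron_lift_rank1. *)
Definition kron_lift (R : rcfType) (n : nat) (c c' : 'cV[R]_n) (r r' : R)
    (X : 'M[R]_n) (x : 'cV[R]_n) : 'M[R]_((n + 1) * (n + 1)) :=
  let A0 := arrowmx (- c) r in
  let A0' := arrowmx (- c') r' in
  let E (k : 'I_n) : 'M[R]_(n + 1) := arrowmx (delta_mx k 0) 0 in
  A0 *t A0'
  + \sum_k x k 0 *: (E k *t A0' + A0 *t E k)
  + \sum_k \sum_l X k l *: (E k *t E l).

Lemma arrowmx_expand (R : rcfType) (n : nat) (c x : 'cV[R]_n) (r : R) :
  arrowmx (x - c) r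
  = arrowmx (- c) r + \sum_k x k 0 *: arrowmx (delta_mx k 0) 0.
Proof.
apply/matrixP => i j; rewrite [RHS]mxE summxE.
under eq_bigr do rewrite mxE.
rewrite /arrowmx.
case: (split_ordP i) => i' ->; case: (split_ordP j) => j' ->.
- rewrite !block_mxEul big1 ?addr0 // => k _.
  by rewrite block_mxEul !mxE mul0rn mulr0.
- rewrite !block_mxEur !mxE addrC (bigD1 i') //= big1 => [|k ki].
    by rewrite block_mxEur !mxE ord1 !eqxx mulr1 addr0.
  by rewrite block_mxEur !mxE eq_sym (negPf ki) mulr0.
- rewrite !block_mxEdl !mxE addrC (bigD1 j') //= big1 => [|k kj].
    by rewrite block_mxEdl !mxE ord1 !eqxx mulr1 addr0.
  by rewrite block_mxEdl !mxE eq_sym (negPf kj) mulr0.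
- rewrite !block_mxEdr big1 ?addr0 // => k _.
  by rewrite block_mxEdr !mxE mul0rn mulr0.
Qed.

Lemma kron_lift_rank1 (R : rcfType) (n : nat) (c c' x : 'cV[R]_n) (r r' : R) :
  kron_lift c c' r r' (x *m x^T) x
  = arrowmx (x - c) r *t arrowmx (x - c') r'.
Proof.
rewrite !arrowmx_expand /kron_lift /=.
move: (arrowmx (- c) r) (arrowmx (- c') r') => A0 A0'.
move: (fun k : 'I_n => arrowmx (delta_mx k 0 : 'cV[R]_n) 0) => E.
apply/matrixP => i j; rewrite !mxE !summxE mulrDr !mulrDl -!addrA.
congr (_ + _); rewrite addrCA [RHS]addrA; congr (_ + _).
  rewrite mulr_sumr mulr_suml -big_split /=; apply: eq_bigr => k _.
  by rewrite !mxE mulrDr mulrA addrC; congr (_ + _); rewrite mulrCA.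
rewrite mulr_suml; apply: eq_bigr => k _.
rewrite summxE mulr_sumr; apply: eq_bigr => l _.
by rewrite !mxE big_ord1 !mxE mulrACA.
Qed.

(* Main.v *)
(* A matrix Z in Ccone is a sum of rank one matrices z z^T with z = (y, s, t)
   isotropic for Q, i.e. s t = |y|^2.  The lifted Kronecker matrix is then the
   sum over z of A(y - t c, t r) (x) A(y - t c', t r').  With e the last basis
   vector and G = [r I; u^T],
     r A(u, r) = G G^T + (r^2 - |u|^2) e e^T,
   and multiplying two such identities bounds r r' times the quadratic form of
   each summand from below by (d.z)(p'.z) + (d'.z)(p.z) + w^2 (d.z)(d'.z), where the
   linear forms p, p' take the values |w x + g|^2, |w x + g'|^2 at
   (x, |x|^2, 1).  Summing over z gives p'.Zd + p.Zd' + w^2 d^T Z d' >= 0,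
   because p and p' are nonnegative on the rotated second-order cone, which
   contains Zd and Zd'.  If r = 0, the last coordinate of Zd forces y = t c for
   all z and the matrix vanishes. *)
Require Import Defs.
From mathcomp Require Import all_boot all_order all_algebra.
From mathcomp Require Import classical_sets reals.
From mathcomp Require Import mxtens ring lra.
Import Order.TTheory GRing.Theory Num.Theory.
Local Open Scope ring_scope.
Local Open Scope classical_set_scope.

Set Implicit Arguments.
Unset Strict Implicit.
Unset Printing Implicit Defensive.

(** * Bilinear forms of a matrix *)

Definition bform (R : rcfType) k (A : 'M[R]_k) (x y : 'cV[R]_k) : R :=
  (x^T *m A *m y) 0 0.

Lemma bformDl (R : rcfType) k (A : 'M[R]_k) x y z :
  bform A (x + y) z = bform A x z + bform A y z.
Proof. by rewrite /bform linearD /= !mulmxDl mxE. Qed.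

Lemma bformDr (R : rcfType) k (A : 'M[R]_k) x y z :
  bform A z (x + y) = bform A z x + bform A z y.
Proof. by rewrite /bform mulmxDr mxE. Qed.

Lemma bformZl (R : rcfType) k (A : 'M[R]_k) (a : R) x y :
  bform A (a *: x) y = a * bform A x y.
Proof. by rewrite /bform linearZ /= -!scalemxAl mxE. Qed.

Lemma bformZr (R : rcfType) k (A : 'M[R]_k) (a : R) x y :
  bform A x (a *: y) = a * bform A x y.
Proof. by rewrite /bform -scalemxAr mxE. Qed.

Definition bformE := (bformDl, bformDr, bformZl, bformZr).

Lemma bform_tr (R : rcfType) k (A : 'M[R]_k) x y : bform A^T x y = bform A y x.
Proof. by rewrite /bform -[in LHS](trmxK y) -!trmx_mul mulmxA mxE. Qed.

Lemma bform_delta (R : rcfType) k (A : 'M[R]_k) i j :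
  bform A (delta_mx i 0) (delta_mx j 0) = A i j.
Proof. by rewrite /bform trmx_delta -rowE -colE !mxE. Qed.

Lemma bform_rank1 (R : rcfType) k (p x y : 'cV[R]_k) :
  bform (p *m p^T) x y = (x^T *m p) 0 0 * (p^T *m y) 0 0.
Proof. by rewrite /bform !mulmxA -mulmxA mxE big_ord1. Qed.

Lemma bform_sum (R : rcfType) k (I : Type) (s : seq I) (F : I -> 'M[R]_k) x y :
  bform (\sum_(i <- s) F i) x y = \sum_(i <- s) bform (F i) x y.
Proof. by rewrite /bform mulmx_sumr mulmx_suml summxE. Qed.

(** * Positive semidefinite matrices and their rank-one decompositions *)

Lemma psd_cauchy_schwarz {R : rcfType} {k} {A : 'M[R]_k} (x y : 'cV[R]_k) :
  psdmx A -> bform A x y ^+ 2 <= bform A x x * bform A y y.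
Proof.
move=> [As Ap].
have S : bform A y x = bform A x y by rewrite -bform_tr As.
have q (a b : R) : 0 <= a ^+ 2 * bform A x x + 2 * a * b * bform A x y
                        + b ^+ 2 * bform A y y.
  by have := Ap (a *: x + b *: y); rewrite -/(bform _ _ _) !bformE S; nra.
have Py : 0 <= bform A y y := Ap y.
have [y0|y0] := eqVneq (bform A y y) 0; last first.
  have {}Py : 0 < bform A y y by rewrite lt_neqAle eq_sym y0.
  (* These coefficients minimize the quadratic form along the line through [x] in direction [y], up
     to scaling. *)
  have := q (bform A y y) (- bform A x y).
  rewrite (_ : _ + _ = bform A y y * (bform A x x * bform A y y
    - bform A x y ^+ 2)); last by ring.
  by rewrite pmulr_rge0 // subr_ge0.
have [->|x0] := eqVneq (bform A x y) 0; first by rewrite y0 mulr0 expr0n.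
(* With [bform A y y = 0] the form [q 1 b] is affine in [b]; this [b] gives it the value -1, a
   contradiction. *)
have := q 1 (- (bform A x x + 1) / (2 * bform A x y)).
rewrite y0 mulr0 addr0 expr1n mul1r mulr1.
by rewrite [2 * _ * _](_ : _ = -(bform A x x + 1)); [lra|field].
Qed.

(* One step of Cholesky elimination along [e]; when [e^T A e = 0] the division
   gives [p = 0], and then already [A e = 0]. *)
Lemma psd_deflate {R : rcfType} {k} {A : 'M[R]_k} (e : 'cV[R]_k) : psdmx A ->
  exists p : 'cV[R]_k, [/\ psdmx (A - p *m p^T), (A - p *m p^T) *m e = 0 &
    forall f : 'cV[R]_k, A *m f = 0 -> (A - p *m p^T) *m f = 0].
Proof.
move=> psdA; have [As Ap] := psdA.
set d := bform A e e; have d0 : 0 <= d := Ap e.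
set p := (Num.sqrt d)^-1 *: (A *m e); exists p.
have pE x : (p^T *m x) 0 0 = (Num.sqrt d)^-1 * bform A e x.
  by rewrite /p linearZ /= trmx_mul As -scalemxAl mxE.
have pE' x : (x^T *m p) 0 0 = (Num.sqrt d)^-1 * bform A e x.
  by rewrite -pE -[in LHS](trmxK p) -trmx_mul mxE.
have sE : (Num.sqrt d)^-1 ^+ 2 = d^-1 by rewrite exprVn sqr_sqrtr.
have bE x y : bform (A - p *m p^T) x y =
    bform A x y - d^-1 * bform A e x * bform A e y.
  have -> : bform (A - p *m p^T) x y = bform A x y - bform (p *m p^T) x y.
    by rewrite /bform mulmxBr mulmxBl !mxE.
  by rewrite bform_rank1 pE pE' -sE; ring.
have mE f : (A - p *m p^T) *m f = A *m f - (d^-1 * bform A e f) *: (A *m e).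
  rewrite mulmxBl -mulmxA [p^T *m f]mx11_scalar pE mul_mx_scalar scalerA -sE.
  by congr (_ - _ *: _); ring.
split.
- split; first by rewrite linearB /= trmx_mul trmxK As.
  move=> x; rewrite -/(bform _ _ _) bE.
  have CS := psd_cauchy_schwarz e x psdA.
  have [d0'|dn] := eqVneq d 0.
    by rewrite d0' invr0 !mul0r subr0; exact: Ap.
  have {}d0 : 0 < d by rewrite lt_neqAle eq_sym dn.
  by rewrite subr_ge0 -mulrA ler_pdivrMl // -expr2.
- rewrite mE -/d; have [d0'|dn] := eqVneq d 0; last first.
    by rewrite mulVf // scale1r subrr.
  rewrite d0' invr0 mul0r scale0r subr0.
  (* For [d = 0], Cauchy-Schwarz against each basis vector kills the entries of [A *m e]. *)
  apply/matrixP => i j; rewrite (ord1 j) [RHS]mxE.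
  have := psd_cauchy_schwarz (delta_mx i 0) e psdA.
  rewrite -/d d0' mulr0 /bform trmx_delta -mulmxA -rowE !mxE => h.
  by apply/eqP; rewrite -sqrf_eq0 eq_le h sqr_ge0.
- by move=> f Af; rewrite mE Af /bform -mulmxA Af mulmx0 mxE mulr0 scale0r subrr.
Qed.

(** Deflation along each basis vector in turn keeps the kernel gained so far, so the final remainder
    kills the whole basis and is zero. *)
Lemma psd_gram {R : rcfType} {k} {A : 'M[R]_k} : psdmx A ->
  exists ps : seq 'cV[R]_k, A = \sum_(p <- ps) p *m p^T.
Proof.
move=> psdA.
suff H (es : seq 'cV[R]_k) : exists (ps : seq 'cV[R]_k) (B : 'M[R]_k),
    [/\ A = \sum_(p <- ps) p *m p^T + B, psdmx B &
        forall e, e \in es -> B *m e = 0].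
  have [ps [B [-> _ Be]]] := H [seq delta_mx i (0 : 'I_1) | i : 'I_k].
  exists ps; rewrite [B](_ : _ = 0) ?addr0 //.
  apply/matrixP => i j; rewrite mxE -bform_delta /bform -mulmxA Be ?mulmx0 ?mxE //.
  by apply: map_f; rewrite mem_enum.
elim: es => [|e es [ps [B [-> psdB Bes]]]].
  by exists [::], A; rewrite big_nil add0r.
have [p [psdC Ce Ck]] := psd_deflate e psdB.
exists (p :: ps), (B - p *m p^T); split => //.
  by rewrite big_cons [p *m _ + _]addrC -addrA [_ + (B - _)]addrC subrK.
by move=> f; rewrite inE => /predU1P[->//|/Bes/Ck].
Qed.

(** A plane rotation of the pair preserves the sum of the rank-one matrices. Its tangent [t] is a
    root of [a + b t + c t^2], which has real roots since [a c < 0]; [n] normalizes [(1, t)]. *)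
Lemma rotate_isotropic (R : rcfType) k (Q : 'M[R]_k) (p q : 'cV[R]_k) :
  bform Q p p * bform Q q q < 0 ->
  exists u v : 'cV[R]_k,
    bform Q u u = 0 /\ u *m u^T + v *m v^T = p *m p^T + q *m q^T.
Proof.
set a := bform Q p p; set c := bform Q q q => ac.
set b := bform Q p q + bform Q q p.
have c0 : c != 0 by apply: contraTneq ac => ->; rewrite mulr0 ltxx.
set s := Num.sqrt (b ^+ 2 - 4 * a * c).
have sE : s ^+ 2 = b ^+ 2 - 4 * a * c by rewrite sqr_sqrtr //; nra.
set t := (s - b) / (2 * c).
have tE : a + b * t + c * t ^+ 2 = 0.
  have -> : a + b * t + c * t ^+ 2 = (s ^+ 2 - (b ^+ 2 - 4 * a * c)) / (4 * c).
    by rewrite /t; field.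
  by rewrite sE subrr mul0r.
set n := (Num.sqrt (1 + t ^+ 2))^-1.
have nE : n ^+ 2 * (1 + t ^+ 2) = 1.
  rewrite exprVn sqr_sqrtr; last by nra.
  by rewrite mulVf // lt0r_neq0 //; nra.
exists (n *: (p + t *: q)), (n *: (q - t *: p)); split.
  rewrite !bformE -/a -/c; transitivity (n ^+ 2 * (a + b * t + c * t ^+ 2)).
    by rewrite /b; ring.
  by rewrite tE mulr0.
apply/matrixP => i j; rewrite !mxE !big_ord1 !mxE.
set x := p i 0; set y := p j 0; set z := q i 0; set w := q j 0.
transitivity (n ^+ 2 * (1 + t ^+ 2) * (x * y + z * w)); first by ring.
by rewrite nE mul1r.
Qed.

(* Sturm and Zhang: a vector with positive and one with negative [Q]-value are
   rotated into a pair containing an isotropic vector, which lowers the number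
   of anisotropic vectors. *)
Lemma sum_isotropic (R : rcfType) k (Q : 'M[R]_k) (ps : seq 'cV[R]_k) :
  \sum_(p <- ps) bform Q p p = 0 ->
  exists qs : seq 'cV[R]_k, \sum_(q <- qs) q *m q^T = \sum_(p <- ps) p *m p^T
    /\ {in qs, forall q, bform Q q q = 0}.
Proof.
have [n] := ubnP (size ps); elim: n => // n IH in ps *.
case: ps => [|p ps] /=; first by exists [::].
rewrite ltnS big_cons => sz sum0.
have [p0|p0] := eqVneq (bform Q p p) 0.
  rewrite p0 add0r in sum0; have [qs [qsE qs0]] := IH _ sz sum0.
  exists (p :: qs); rewrite !big_cons qsE; split => // q.
  by rewrite inE => /predU1P[->|/qs0].
(* Without such a [q], multiplying the zero sum by [bform Q p p] would give a positive number. *)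
have [q qps pq] : exists2 q, q \in ps & bform Q p p * bform Q q q < 0.
  apply/hasP; apply/negPn/negP => /hasPn nh.
  have : 0 < bform Q p p ^+ 2 by rewrite exprn_even_gt0.
  have : 0 <= bform Q p p * \sum_(q <- ps) bform Q q q.
    rewrite mulr_sumr big_seq; apply: sumr_ge0 => q /nh; by rewrite -leNgt.
  by move: sum0; set S := \sum_(_ <- _) _; nra.
have [u [v [u0 uvE]]] := rotate_isotropic pq.
have psE (V : nmodType) (F : _ -> V) :
    \sum_(x <- ps) F x = F q + \sum_(x <- rem q ps) F x.
  by rewrite (perm_big _ (perm_to_rem qps)) big_cons.
(* The sum of the [Q]-values is the trace of [Q] against the preserved matrix, so the shorter list
   again has sum zero. *)
have uvQ : bform Q u u + bform Q v v = bform Q p p + bform Q q q.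
  have tE x : bform Q x x = \tr (Q *m (x *m x^T)).
    by rewrite mulmxA mxtrace_mulC mulmxA trace_mx11.
  by rewrite !tE -!mxtraceD -!mulmxDr uvE.
have [||qs [qsE qs0]] := IH (v :: rem q ps).
- by rewrite /= size_rem // prednK //; case: (ps) qps.
- move: sum0; rewrite psE big_cons addrA -uvQ u0 add0r //.
exists (u :: qs); rewrite !big_cons qsE big_cons psE !addrA uvE.
by split=> // x; rewrite inE => /predU1P[->|/qs0].
Qed.

Lemma psd_isotropic_gram {R : rcfType} {k} {Q Z : 'M[R]_k} :
  psdmx Z -> mxinner Q Z = 0 ->
  exists qs : seq 'cV[R]_k, Z = \sum_(q <- qs) q *m q^T
    /\ {in qs, forall q, bform Q q q = 0}.
Proof.
move=> /psd_gram [ps ->] QZ.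
have [|qs [<- qs0]] := @sum_isotropic _ _ Q ps; last by exists qs.
rewrite -[RHS]QZ /mxinner mulmx_sumr raddf_sum /=; apply: eq_bigr => x _.
by rewrite mulmxA mxtrace_mulC mulmxA trace_mx11.
Qed.

(** * The Euclidean inner product *)

Notation dot := (bform 1%:M).

Lemma dotE (R : rcfType) k (u v : 'cV[R]_k) : dot u v = (u^T *m v) 0 0.
Proof. by rewrite /bform mulmx1. Qed.

Lemma dot_sum (R : rcfType) k (u v : 'cV[R]_k) :
  dot u v = \sum_i u i 0 * v i 0.
Proof. by rewrite dotE mxE; apply: eq_bigr => i _; rewrite mxE. Qed.

Lemma dotC (R : rcfType) k (u v : 'cV[R]_k) : dot u v = dot v u.
Proof. by rewrite -bform_tr trmx1. Qed.

Lemma dot_ge0 (R : rcfType) k (u : 'cV[R]_k) : 0 <= dot u u.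
Proof. by rewrite dot_sum sumr_ge0 // => i _; rewrite -expr2 sqr_ge0. Qed.

Lemma dot_eq0 (R : rcfType) k (u : 'cV[R]_k) : dot u u = 0 -> u = 0.
Proof.
rewrite dot_sum => /eqP; rewrite psumr_eq0; last first.
  by move=> i _; rewrite -expr2 sqr_ge0.
move=> /allP u0; apply/matrixP => i j; rewrite (ord1 j) mxE.
by have /eqP/eqP := u0 i (mem_index_enum _); rewrite -expr2 sqrf_eq0 => /eqP.
Qed.

Lemma norm2_sqr (R : rcfType) k (u : 'cV[R]_k) : norm2 u ^+ 2 = dot u u.
Proof.
have E : \sum_i u i 0 ^+ 2 = dot u u by rewrite dot_sum.
by rewrite /norm2 E sqr_sqrtr // dot_ge0.
Qed.

Lemma dot_col_mx (R : rcfType) k l (u u' : 'cV[R]_k) (v v' : 'cV[R]_l) :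
  dot (col_mx u v) (col_mx u' v') = dot u u' + dot v v'.
Proof. by rewrite !dotE tr_col_mx mul_row_col mxE. Qed.

Lemma dot_scalar (R : rcfType) (s t : R) : dot (s%:M : 'cV_1) t%:M = s * t.
Proof. by rewrite dotE tr_scalar_mx -scalar_mxM mxE. Qed.

(** * Homogeneous coordinates and the rotated second-order cone *)

Section HomogeneousVectors.
Variables (R : rcfType) (n : nat).
Implicit Types (y c : 'cV[R]_n) (z : 'cV[R]_(n + (1 + 1))) (s t r : R).

Definition hvec y s t : 'cV[R]_(n + (1 + 1)) := col_mx y (col_mx s%:M t%:M).
Definition hy z : 'cV[R]_n := usubmx z.
Definition hs z : R := usubmx (dsubmx z) 0 0.
Definition ht z : R := dsubmx (dsubmx z) 0 0.

Lemma hvecK z : hvec (hy z) (hs z) (ht z) = z.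
Proof. by rewrite /hvec -!mx11_scalar !vsubmxK. Qed.

Lemma dot_hvec y s t y' s' t' :
  dot (hvec y s t) (hvec y' s' t') = dot y y' + s * s' + t * t'.
Proof. by rewrite !dot_col_mx !dot_scalar addrA. Qed.

Lemma dvecE c r : dvec c r = hvec (2 *: c) (- 1) (r ^+ 2 - dot c c).
Proof. by rewrite /dvec norm2_sqr /hvec raddfN. Qed.

Lemma bform_Qmx z : bform (Qmx R n) z z = 2 * (hs z * ht z - dot (hy z) (hy z)).
Proof.
have -> : bform (Qmx R n) z z = dot z (Qmx R n *m z).
  by rewrite dotE mulmxA.
rewrite -[z in LHS]hvecK; set y := hy z; set s := hs z; set t := ht z.
have -> : Qmx R n *m hvec y s t = hvec (- 2 *: y) t s.
  rewrite /Qmx /hvec !mul_block_col !mul0mx !mul1mx addr0 !add0r addr0.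
  by rewrite mulNmx mul_scalar_mx -scaleNr.
by rewrite dot_hvec bformE; ring.
Qed.

(** [Pmx] carries the rotated cone to the second-order cone, because [(s + t)^2 - (s - t)^2 = 4 s t]
    matches [|2 y|^2 = 4 |y|^2]. *)
Lemma soc_Pmx z : soc (Pmx R n *m z) ->
  [/\ 0 <= hs z, 0 <= ht z & dot (hy z) (hy z) <= hs z * ht z].
Proof.
rewrite -[in X in X -> _](hvecK z); set y := hy z; set s := hs z; set t := ht z.
have -> : Pmx R n *m hvec y s t = hvec (2 *: y) (s - t) (s + t).
  rewrite /Pmx /hvec !mul_block_col !mul0mx !mul1mx addr0 !add0r mulNmx mul1mx.
  by rewrite mul_scalar_mx raddfB raddfD.
rewrite /soc /= /hvec !col_mxKd col_mxKu col_mxKu [in X in _ <= X]mxE eqxx mulr1n.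
set N := norm2 _ => h.
have N0 : 0 <= N by rewrite sqrtr_ge0.
have : N ^+ 2 <= (s + t) ^+ 2 by rewrite ler_sqr // nnegrE (le_trans N0).
rewrite norm2_sqr dot_col_mx dot_scalar !bformE => h2.
have := dot_ge0 y; set yy := dot y y in h2 * => yy0.
have st : yy <= s * t by nra.
have {h N0}h : 0 <= s + t by apply: le_trans h.
by split; [rewrite leNgt; apply/negP; nra | rewrite leNgt; apply/negP; nra |].
Qed.

(** This homogenizes [r^2 - |x - c|^2], the value of [dvec c r] at [(x, |x|^2, 1)]; the factor
    [ht z] avoids dividing by [t]. *)
Lemma dot_dvec z c r : hs z * ht z = dot (hy z) (hy z) ->
  ht z * dot z (dvec c r)
  = (ht z * r) ^+ 2 - dot (hy z - ht z *: c) (hy z - ht z *: c).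
Proof.
rewrite -[X in dot X (dvec _ _)](hvecK z) dvecE dot_hvec -scaleNr !bformE (dotC c) => h.
by rewrite -h; ring.
Qed.

(* The linear form whose value at [(x, |x|^2, 1)] is [|w *: x + g|^2]. *)
Definition sqvec (w : R) (g : 'cV[R]_n) :=
  hvec ((2 * w) *: g) (w ^+ 2) (dot g g).

(** The last term vanishes at isotropic vectors; it is kept for vectors such as [Z d], which are
    only known to lie in the cone. *)
Lemma dot_sqvec w g z : ht z * dot (sqvec w g) z
  = dot (w *: hy z + ht z *: g) (w *: hy z + ht z *: g)
    + w ^+ 2 * (hs z * ht z - dot (hy z) (hy z)).
Proof.
by rewrite -[X in dot (sqvec _ _) X](hvecK z) dot_hvec !bformE (dotC g (hy z)); ring.
Qed.

Lemma dot_sqvec_ge0 w g z : 0 <= hs z -> 0 <= ht z ->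
  dot (hy z) (hy z) <= hs z * ht z -> 0 <= dot (sqvec w g) z.
Proof.
move=> s0 t0 h; have [t00|tn] := eqVneq (ht z) 0.
  (* At [t = 0] the cone inequality forces [y = 0], and only [w^2 s] survives. *)
  have y0 : hy z = 0.
    apply: dot_eq0; apply/eqP; rewrite eq_le dot_ge0 andbT.
    by rewrite (le_trans h) // t00 mulr0.
  rewrite -(hvecK z) dot_hvec y0 t00 dotE mulmx0 mxE add0r mulr0 addr0.
  by rewrite mulr_ge0 ?sqr_ge0.
have tp : 0 < ht z by rewrite lt_neqAle eq_sym tn.
rewrite -(pmulr_rge0 _ tp) dot_sqvec addr_ge0 ?dot_ge0 //.
by rewrite mulr_ge0 ?sqr_ge0 ?subr_ge0.
Qed.

End HomogeneousVectors.

(** * Arrow matrices and their Kronecker products *)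

Section ArrowMatrices.
Variables (R : rcfType) (n : nat).
Implicit Types (a b c : 'cV[R]_n) (r s t : R).

Lemma arrowmx_hom (c y : 'cV[R]_n) (r t : R) :
  arrowmx (y - t *: c) (t * r)
  = t *: arrowmx (- c) r + \sum_k y k 0 *: arrowmx (delta_mx k 0) 0.
Proof.
rewrite arrowmx_expand; congr (_ + _).
rewrite /arrowmx scale_block_mx !scale_scalar_mx scalerN.
by congr block_mx; apply/matrixP => i j; rewrite !mxE mulrN.
Qed.

(** For [y = t x] this is [t^2] times the Kronecker product at the point [x]. *)
Definition hkron c c' r r' (z : 'cV[R]_(n + (1 + 1))) :=
  arrowmx (hy z - ht z *: c) (ht z * r) *t arrowmx (hy z - ht z *: c') (ht z * r').

(** Each factor is linear in [(t, y)], so the sum depends on the vectors only through their second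
    moments. *)
Lemma tensmx_affine_sum (I : Type) (qs : seq I) (t : I -> R) (y : I -> 'I_n -> R)
    k (A B : 'M[R]_k) (E : 'I_n -> 'M[R]_k) :
  \sum_(z <- qs) (t z *: A + \sum_k y z k *: E k)
                 *t (t z *: B + \sum_k y z k *: E k)
  = (\sum_(z <- qs) t z * t z) *: (A *t B)
    + \sum_k (\sum_(z <- qs) t z * y z k) *: (E k *t B + A *t E k)
    + \sum_k \sum_l (\sum_(z <- qs) y z k * y z l) *: (E k *t E l).
Proof.
apply/matrixP => i j; rewrite !mxE !summxE.
set i1 := (_ i).1; set j1 := (_ j).1; set i2 := (_ i).2; set j2 := (_ j).2.
transitivity (\sum_(z <- qs) (t z * t z * (A i1 j1 * B i2 j2)
  + \sum_k t z * y z k * (E k i1 j1 * B i2 j2 + A i1 j1 * E k i2 j2)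
  + \sum_k \sum_l y z k * y z l * (E k i1 j1 * E l i2 j2))).
  apply: eq_bigr => z _; rewrite !mxE !summxE mulrDr !mulrDl -!addrA.
  congr (_ + _); first by rewrite mulrACA.
  rewrite addrA; congr (_ + _).
    rewrite mulr_sumr mulr_suml -big_split /=; apply: eq_bigr => l _.
    by rewrite !mxE; ring.
  rewrite mulr_suml; apply: eq_bigr => l _.
  by rewrite mulr_sumr; apply: eq_bigr => m _; rewrite !mxE; ring.
rewrite !big_split /= -mulr_suml; congr (_ + _ + _).
  rewrite exchange_big /=; apply: eq_bigr => l _.
  by rewrite !mxE mulr_suml.
rewrite exchange_big /=; apply: eq_bigr => l _.
rewrite summxE exchange_big /=; apply: eq_bigr => m _.
by rewrite !mxE mulr_suml.
Qed.

(** The second moments of [(t, y)] are entries of [Z]; [corner Z = 1] supplies the coefficient of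
    the constant part. *)
Lemma kron_lift_sum c c' r r' (qs : seq 'cV[R]_(n + (1 + 1))) Z :
  Z = \sum_(z <- qs) z *m z^T -> corner Z = 1 ->
  kron_lift c c' r r' (piX Z) (pix Z) = \sum_(z <- qs) hkron c c' r r' z.
Proof.
move=> ZE.
have zE i j : Z i j = \sum_(z <- qs) z i 0 * z j 0.
  by rewrite ZE summxE; apply: eq_bigr => z _; rewrite mxE big_ord1 !mxE.
have XE k l : piX Z k l = \sum_(z <- qs) hy z k 0 * hy z l 0.
  by rewrite !mxE zE; apply: eq_bigr => z _; rewrite !mxE.
have xE k : pix Z k 0 = \sum_(z <- qs) ht z * hy z k 0.
  by rewrite !mxE zE; apply: eq_bigr => z _; rewrite /ht !mxE mulrC.
have cE : corner Z = \sum_(z <- qs) ht z * ht z.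
  by rewrite /corner !mxE zE; apply: eq_bigr => z _; rewrite /ht !mxE.
rewrite cE => t1.
rewrite /hkron; under [RHS]eq_bigr do rewrite !arrowmx_hom.
rewrite (tensmx_affine_sum qs (@ht R n) (fun z k => hy z k 0)) t1 scale1r.
rewrite /kron_lift; congr (_ + _ + _); apply: eq_bigr => k _; first by rewrite xE.
by apply: eq_bigr => l _; rewrite XE.
Qed.

Lemma arrowmx0 : arrowmx (0 : 'cV[R]_n) 0 = 0.
Proof.
have Z k : (0%:M : 'M[R]_k) = 0 by apply/matrixP => i j; rewrite !mxE mul0rn.
by rewrite /arrowmx trmx0 !Z block_mx0.
Qed.

Lemma tr_arrowmx a r : (arrowmx a r)^T = arrowmx a r.
Proof. by rewrite /arrowmx tr_block_mx !tr_scalar_mx trmxK. Qed.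

Definition arrow_factor a r : 'M[R]_(n + 1, n) := col_mx r%:M a^T.

Definition lastv : 'cV[R]_(n + 1) := col_mx 0 1.

Lemma arrow_factorE a r :
  r *: arrowmx a r = arrow_factor a r *m (arrow_factor a r)^T
    + (r ^+ 2 - dot a a) *: (lastv *m lastv^T).
Proof.
rewrite /arrow_factor /lastv !tr_col_mx !mul_col_row trmx0 trmx1 trmxK.
rewrite !mul0mx mulmx0 mul1mx tr_scalar_mx mul_scalar_mx mul_mx_scalar.
rewrite /arrowmx !scale_block_mx add_block_mx !scaler0 !addr0.
congr block_mx.
- by rewrite mul_scalar_mx.
- rewrite [a^T *m a]mx11_scalar -dotE; apply/matrixP => i j.
  by rewrite !ord1 !mxE eqxx; ring.
Qed.

Lemma mul_arrow_factor a r (x : 'cV[R]_(n + 1)) :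
  (arrow_factor a r)^T *m x = r *: usubmx x + dsubmx x 0 0 *: a.
Proof.
rewrite -[in LHS](vsubmxK x) /arrow_factor tr_col_mx mul_row_col trmxK.
by rewrite tr_scalar_mx mul_scalar_mx [dsubmx x in LHS]mx11_scalar mul_mx_scalar.
Qed.

(** Applying [arrow_factorE] to both arrow matrices splits the trace into four weighted squared
    Frobenius norms. The left side is three of them; the fourth, that of [G^T V H], has weight 1 and
    is dropped. *)
Lemma trace_arrow_ge (V : 'M[R]_(n + 1)) a b r s :
  let w := drsubmx V 0 0 in
  let ga := r *: ursubmx V + w *: a in
  let gb := s *: (dlsubmx V)^T + w *: b in
  (r ^+ 2 - dot a a) * dot gb gb + (s ^+ 2 - dot b b) * dot ga ga
    + (r ^+ 2 - dot a a) * (s ^+ 2 - dot b b) * w ^+ 2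
  <= r * s * \tr (V^T *m arrowmx a r *m V *m arrowmx b s).
Proof.
cbv zeta; set w := drsubmx V 0 0.
set ga := r *: _ + w *: a; set gb := s *: _ + w *: b.
have -> : r * s * \tr (V^T *m arrowmx a r *m V *m arrowmx b s)
    = \tr (V^T *m (r *: arrowmx a r) *m V *m (s *: arrowmx b s)).
  by rewrite -!scalemxAr -!scalemxAl !mxtraceZ; ring.
rewrite !arrow_factorE.
set al := r ^+ 2 - _; set be := s ^+ 2 - _.
set G := arrow_factor a r; set H := arrow_factor b s.
have trE k l (P : 'M[R]_(n + 1, k)) (S : 'M[R]_(n + 1, l)) :
    \tr (V^T *m (P *m P^T) *m V *m (S *m S^T))
    = \tr ((P^T *m V *m S)^T *m (P^T *m V *m S)).
  by rewrite !mulmxA mxtrace_mulC !trmx_mul trmxK !mulmxA.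
have tr_ge0 k l (P : 'M[R]_(k, l)) : 0 <= \tr (P^T *m P).
  rewrite sumr_ge0 // => i _; rewrite mxE sumr_ge0 // => j _.
  by rewrite mxE -expr2 sqr_ge0.
have lastE (x : 'cV[R]_(n + 1)) : lastv^T *m x = dsubmx x.
  by rewrite -[x in LHS]vsubmxK /lastv tr_col_mx mul_row_col trmx0 mul0mx add0r
    trmx1 mul1mx.
have VE : V = block_mx (ulsubmx V) (ursubmx V) (dlsubmx V) w%:M.
  by rewrite -mx11_scalar submxK.
have -> : ga = G^T *m V *m lastv.
  rewrite -mulmxA {1}VE /lastv mul_block_col !mulmx0 !mulmx1 !add0r.
  by rewrite mul_arrow_factor col_mxKu col_mxKd !mxE eqxx.
have -> : gb = (lastv^T *m V *m H)^T.
  rewrite !trmx_mul trmxK {1}VE tr_block_mx /lastv mul_block_col !mulmx0 !mulmx1.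
  by rewrite !add0r mul_arrow_factor col_mxKu col_mxKd !mxE eqxx.
rewrite -subr_ge0.
have -> : w ^+ 2 = \tr ((lastv^T *m V *m lastv)^T *m (lastv^T *m V *m lastv)).
  rewrite trace_mx11 -mulmxA lastE {1 2}VE /lastv mul_block_col !mulmx0 !mulmx1.
  by rewrite !add0r col_mxKd !mxE big_ord1 !mxE eqxx.
rewrite !dotE -!trace_mx11 trmxK [\tr (lastv^T *m V *m H *m _)]mxtrace_mulC.
rewrite (mulmxDr V^T) -scalemxAr !mulmxDl -!scalemxAl !(mulmxDr (_ *m V)).
rewrite -!scalemxAr !(mxtraceD, mxtraceZ) !trE.
by have := tr_ge0 _ _ (G^T *m V *m H); lra.
Qed.

(** Reshaping [x] into the square matrix [V] turns the action of [A *t B] into [A V B^T]. *)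
Lemma bform_tensmx k (A B : 'M[R]_k) (x : 'cV[R]_(k * k)) :
  let V := \matrix_(p, q) x (mxtens_index (p, q)) 0 in
  bform (A *t B) x x = \tr (V^T *m A *m V *m B^T).
Proof.
move=> V.
have sumE (F : 'I_(k * k) -> R) :
    \sum_i F i = \sum_p \sum_q F (mxtens_index (p, q)).
  rewrite pair_big; apply: reindex => /=.
  by exists (@mxtens_unindex k k) => i; rewrite (mxtens_indexK, mxtens_unindexK)
    -?surjective_pairing.
have ABx p q : (A *t B *m x) (mxtens_index (p, q)) 0 = (A *m V *m B^T) p q.
  rewrite !mxE sumE exchange_big /=; apply: eq_bigr => j _.
  rewrite !mxE mulr_suml; apply: eq_bigr => i _.
  by rewrite tensmxE mxE mulrAC.
rewrite /bform -mulmxA mxE sumE -!mulmxA mxtrace_mulC /mxtrace.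
apply: eq_bigr => p _; rewrite mxE; apply: eq_bigr => q _.
by rewrite ABx [x^T _ _]mxE [V^T _ _]mxE [V _ _]mxE mulmxA mulrC.
Qed.

End ArrowMatrices.

(** * Lower bound for one summand, and the case of zero radius *)

Section KroneckerForm.
Variables (R : rcfType) (n : nat).
Implicit Types (c : 'cV[R]_n) (z : 'cV[R]_(n + (1 + 1))) (r : R).

Lemma hkron_ge c c' r r' z (x : 'cV[R]_((n + 1) * (n + 1))) :
  hs z * ht z = dot (hy z) (hy z) ->
  let V := \matrix_(p, q) x (mxtens_index (p, q)) 0 in
  let w := drsubmx V 0 0 in
  let g := r *: ursubmx V - w *: c in
  let g' := r' *: (dlsubmx V)^T - w *: c' in
  dot z (dvec c r) * dot (sqvec w g') z + dot z (dvec c' r') * dot (sqvec w g) z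
    + w ^+ 2 * (dot z (dvec c r) * dot z (dvec c' r'))
  <= r * r' * bform (hkron c c' r r' z) x x.
Proof.
move=> h; cbv zeta; rewrite /hkron bform_tensmx tr_arrowmx.
set V := \matrix_(_, _) _.
have := trace_arrow_ge V (hy z - ht z *: c) (hy z - ht z *: c')
  (ht z * r) (ht z * r').
rewrite -!dot_dvec //; set T := \tr _; cbv zeta.
set w := drsubmx V 0 0; set g := r *: _ - _; set g' := r' *: _ - _.
have E (a b : 'cV[R]_n) (u : R) : (ht z * u) *: a + w *: (hy z - ht z *: b)
    = w *: hy z + ht z *: (u *: a - w *: b).
  by rewrite !scalerBr !scalerA addrCA [w * ht z]mulrC.
have sq (a : 'cV[R]_n) : dot (w *: hy z + ht z *: a) (w *: hy z + ht z *: a)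
    = ht z * dot (sqvec w a) z by rewrite dot_sqvec h subrr mulr0 addr0.
rewrite !E -/g -/g' !sq.
(* For [t != 0] both sides of the trace bound carry a factor [t^2], which cancels. *)
have [t0 _|t0] := eqVneq (ht z) 0; last first.
  have tp : 0 < ht z ^+ 2 by rewrite exprn_even_gt0.
  rewrite -[in X in _ -> X](ler_pM2l tp).
  move: (dot z _) (dot z _) (dot (sqvec w g) z) (dot (sqvec w g') z) T.
  move: w (ht z) {E sq g g' h t0 tp} => w t D D' P P' T le.
  lra.
(* For [t = 0] the trace vanishes, each [d]-value is [-s] and each [sqvec]-value is [w^2 s], so the
   left side is [-(s w)^2]. *)
have y0 : hy z = 0 by apply: dot_eq0; rewrite -h t0 mulr0.
have T0 : T = 0.
  by rewrite /T t0 y0 !mul0r !scale0r subrr arrowmx0 mulmx0 linear0.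
have zE (a : 'cV[R]_n) u v : dot z (hvec a u v) = hs z * u.
  by rewrite -[in LHS](hvecK z) dot_hvec y0 t0 dotE trmx0 mul0mx mxE; ring.
rewrite T0 !dvecE ![dot (sqvec _ _) _]dotC !zE.
by have := sqr_ge0 (hs z * w); nra.
Qed.

Lemma hkron_sym c c' r r' z : (hkron c c' r r' z)^T = hkron c c' r r' z.
Proof. by rewrite /hkron trmx_tens !tr_arrowmx. Qed.

(** At radius 0 every summand equals [-|y - t c|^2], so a nonnegative sum forces all of them to
    vanish. *)
Lemma zero_radius_center c (qs : seq 'cV[R]_(n + (1 + 1))) :
  {in qs, forall z, hs z * ht z = dot (hy z) (hy z)} ->
  0 <= \sum_(z <- qs) ht z * dot z (dvec c 0) ->
  {in qs, forall z, hy z - ht z *: c = 0}.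
Proof.
move=> qs0; rewrite big_seq; under eq_bigr => z zq.
  rewrite dot_dvec ?qs0 // mulr0 expr0n sub0r; over.
rewrite -big_seq sumrN oppr_ge0 => le0 z zq; apply: dot_eq0.
have /eqP : \sum_(z <- qs) dot (hy z - ht z *: c) (hy z - ht z *: c) = 0.
  by apply/eqP; rewrite eq_le le0 sumr_ge0 // => q _; exact: dot_ge0.
rewrite psumr_eq0 => [/allP/(_ z zq)/eqP //|q _]; exact: dot_ge0.
Qed.

End KroneckerForm.

Theorem theorem1 (R : realType) (n m : nat) (hn : (1 <= n)%N) (hm : (2 <= m)%N)
    (c : 'I_m -> 'cV[R]_n) (r : 'I_m -> R) (hS : ball_inter c r !=set0)
    (Z : 'M[R]_(n + (1 + 1))) (hZ : Ccone c r Z) (hZ1 : corner Z = 1)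
    (i j : 'I_m) :
  psdmx (kron_lift (c i) (c j) (r i) (r j) (piX Z) (pix Z)).
Proof.
have r_ge0 k : 0 <= r k.
  by have [x /(_ k)] := hS; apply: le_trans; exact: sqrtr_ge0.
have [psdZ QZ socZ ddZ] := hZ.
have [qs [ZE qsQ]] := psd_isotropic_gram psdZ QZ.
have qs0 : {in qs, forall z, hs z * ht z = dot (hy z) (hy z)}.
  by move=> z /qsQ; rewrite bform_Qmx => h; lra.
rewrite (kron_lift_sum _ _ _ _ ZE hZ1).
split=> [|x].
  by rewrite raddf_sum; apply: eq_bigr => z _; exact: hkron_sym.
rewrite -/(bform _ _ _) bform_sum.
have ZdE (p d : 'cV[R]_(n + (1 + 1))) :
    dot p (Z *m d) = \sum_(z <- qs) dot z d * dot p z.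
  rewrite dotE mulmxA -/(bform _ _ _) ZE bform_sum; apply: eq_bigr => z _.
  by rewrite bform_rank1 !dotE mulrC.
have Zd k : [/\ 0 <= hs (Z *m dvec (c k) (r k)), 0 <= ht (Z *m dvec (c k) (r k)) &
    dot (hy (Z *m dvec (c k) (r k))) (hy (Z *m dvec (c k) (r k)))
    <= hs (Z *m dvec (c k) (r k)) * ht (Z *m dvec (c k) (r k))].
  by apply: soc_Pmx; rewrite mulmxA.
have r0 k : r k = 0 ->
    {in qs, forall z, arrowmx (hy z - ht z *: c k) (ht z * r k) = 0}.
  move=> rk0; have [_ t0 _] := Zd k.
  suff yE : {in qs, forall z, hy z - ht z *: c k = 0}.
    by move=> z /yE ->; rewrite rk0 mulr0 arrowmx0.
  apply: zero_radius_center => //; move: t0.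
  (* As a pairing with [(0, 0, 1)], the last coordinate of [Z d] expands over [qs] by [ZdE]. *)
  have tE z : ht z = dot (hvec 0 0 1) z.
    by rewrite -[in RHS](hvecK z) dot_hvec dotE trmx0 mul0mx mxE; ring.
  by rewrite tE ZdE rk0 => t0; under eq_bigr do rewrite tE mulrC.
have kron0 : r i * r j = 0 ->
    \sum_(z <- qs) bform (hkron (c i) (c j) (r i) (r j) z) x x = 0.
  move/eqP; rewrite mulf_eq0 big_seq => /orP[] /eqP/r0 h; rewrite big1 // => z /h;
    by rewrite /hkron => ->; rewrite ?tens0mx ?tensmx0 /bform mulmx0 mul0mx mxE.
have [/kron0 -> //|rr] := eqVneq (r i * r j) 0.
have {}rr : 0 < r i * r j by rewrite lt_neqAle eq_sym rr mulr_ge0.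
have sum_ge0 w g k :
    0 <= \sum_(z <- qs) dot z (dvec (c k) (r k)) * dot (sqvec w g) z.
  by have [? ? ?] := Zd k; rewrite -ZdE dot_sqvec_ge0.
have dd_ge0 : 0 <= \sum_(z <- qs) dot z (dvec (c i) (r i)) * dot z (dvec (c j) (r j)).
  under eq_bigr do rewrite mulrC [dot _ (dvec (c i) _)]dotC.
  by rewrite -ZdE dotE mulmxA.
(* The data [w], [g], [g'] depend on [x] but not on [z], so the summed bounds become pairings with
   [Z d]. *)
rewrite -(pmulr_rge0 _ rr) mulr_sumr big_seq.
apply: le_trans (ler_sum _ (fun z zq => hkron_ge (c i) (c j) (r i) (r j) x (qs0 z zq))).
cbv zeta; rewrite -big_seq !big_split -mulr_sumr /=.
set w := drsubmx _ 0 0; set g := r i *: _ - _; set g' := r j *: _ - _.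
apply: addr_ge0.
  by apply: addr_ge0; [exact: (sum_ge0 w g' i)|exact: (sum_ge0 w g j)].
apply: mulr_ge0; first exact: sqr_ge0.
exact: dd_ge0.
Qed.
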